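(* Let $(\Omega,\mathcal F,P)$ be a probability space and let $\{\mathcal F_t\}_{t\ge 1}$ be an increasing sequence of sub-$\sigma$-fields of $\mathcal F$. Let $\boldsymbol\Theta\subset\mathbb R^k$ and, for each $t\ge1$, let $\mathbf f_t(\boldsymbol\theta)$, $\boldsymbol\theta\in\boldsymbol\Theta$, be an $\mathbb R^r$-valued $\mathcal F_t$-measurable random function. Assume: (1) $\boldsymbol\Theta$ is a bounded subset of $\mathbb R^k$ and each $\mathbf f_t(\boldsymbol\theta)$ is continuous in $\boldsymbol\theta$ on $\boldsymbol\Theta$. (2) There exist a positive integer $d$ and positive numbers $\delta,\alpha,M$ such that for any $t>d$, any $0<s_2-s_1\le\delta$, any $\boldsymbol\theta\in\boldsymbol\Theta$ and any $\mathbf a\in\mathbb R^r$ with $\|\mathbf a\|=1$, $$P\bigl(s_1<\mathbf a^{\mathrm T}\mathbf f_t(\boldsymbol\theta)\le s_2\mid\mathcal F_{t-d}\bigr)\le M(s_2-s_1)^\alpha\quad\text{a.s.}$$ (3) There exist $\tau>0$ and nonnegative random variables $B_t$ with $\sup_{t\ge1}\mathrm E(B_t)\le C_1$ for some $C_1>0$ such that for all $\boldsymbol\xi_1,\boldsymbol\xi_2\in\boldsymbol\Theta$ with $\|\boldsymbol\xi_1-\boldsymbol\xi_2\|<\tau$, $$\|\mathbf f_t(\boldsymbol\xi_1)-\mathbf f_t(\boldsymbol\xi_2)\|\le B_t\|\boldsymbol\xi_1-\boldsymbol\xi_2\|\quad\text{a.s.}$$ (4) There exists $C_2>0$ such that $\sup_{t\ge1}\mathrm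 E\bigl(\sup_{\boldsymbol\theta\in\boldsymbol\Theta}\|\mathbf f_t(\boldsymbol\theta)\|^2\bigr)\le C_2$. Then for any $q\ge1$, $$\mathrm E\Bigl\{\sup_{\boldsymbol\theta\in\boldsymbol\Theta}\lambda_{\min}^{-q}\Bigl(n^{-1}\sum_{t=1}^n\mathbf f_t(\boldsymbol\theta)\mathbf f_t^{\mathrm T}(\boldsymbol\theta)\Bigr)\Bigr\}=O(1)\quad\text{as }n\to\infty.$$
   Context: $\|\cdot\|$ is the Euclidean norm. $\lambda_{\min}(L)$ is the minimum eigenvalue of a symmetric matrix $L$, and $\lambda_{\min}^{-q}(L)=(\lambda_{\min}(L))^{-q}$, interpreted as $+\infty$ when $\lambda_{\min}(L)=0$. The $O(1)$ statement means that the sequence is finite and bounded for all sufficiently large $n$. *)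

(* Defs.v *)
From HB Require Import structures.
From mathcomp Require Import all_boot all_order all_algebra.
From mathcomp Require Import all_classical all_reals all_analysis.
Import Order.TTheory GRing.Theory Num.Theory.
Import numFieldNormedType.Exports.

Set Implicit Arguments.
Unset Strict Implicit.
Unset Printing Implicit Defensive.

Local Open Scope classical_set_scope.
Local Open Scope ring_scope.

(* The library norm on 'cV[R]_n is the max norm, hence this definition. *)
Definition enorm (R : realType) (n : nat) (x : 'cV[R]_n) : R :=
  Num.sqrt (\sum_(i < n) x i ord0 ^+ 2).

(* When A is symmetric and n > 0 the spectrum is finite and nonempty, so this
   infimum is a minimum. *)
Definition lambda_min (R : realType) (n : nat) (A : 'M[R]_n) : R :=
  inf [set a : R | eigenvalue A a].

(* The zero case is explicit because powR sends 0 `^ (- q) to 0 when q != 0. *)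
Definition lambda_min_negpow (R : realType) (n : nat) (q : R) (A : 'M[R]_n)
    : \bar R :=
  if lambda_min A == 0 then +oo%E else (lambda_min A `^ (- q))%:E.

Definition second_moment_matrix (R : realType) (r : nat) (u : nat -> 'cV[R]_r)
    (n : nat) : 'M[R]_r :=
  n%:R^-1 *: \sum_(1 <= t < n.+1) u t *m (u t)^T.

(* Time starts at 1; the value at 0 is irrelevant. *)
Definition is_filtration (d : measure_display) (T : measurableType d)
    (F : nat -> set (set T)) : Prop :=
  [/\ forall t, (1 <= t)%N -> sigma_algebra setT (F t),
      forall t, (1 <= t)%N -> F t `<=` measurable
    & forall s t, (1 <= s)%N -> (s <= t)%N -> F s `<=` F t].

(* For a sigma-algebra G the measurable sets of g_sigma_algebraType G are
   exactly the elements of G. *)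
Definition measurable_wrt (R : realType) (T : pointedType) (G : set (set T))
    (g : T -> R) : Prop :=
  measurable_fun [set: g_sigma_algebraType G]
    (g : g_sigma_algebraType G -> R).

Definition is_cond_prob (d : measure_display) (T : measurableType d)
    (R : realType) (P : probability T R) (G : set (set T)) (A : set T)
    (g : T -> R) : Prop :=
  [/\ measurable_wrt G g,
      P.-integrable setT (EFin \o g)
    & forall D, G D -> (\int[P]_(w in D) (g w)%:E = P (A `&` D))%E].

(* P(A | G) <= c a.s.: versions of P(A | G) are a.s. equal, so it does not
   matter which one is bounded. *)
Definition cond_prob_le (d : measure_display) (T : measurableType d)
    (R : realType) (P : probability T R) (G : set (set T)) (A : set T)
    (c : R) : Prop :=
  exists2 g : T -> R, is_cond_prob P G A g & {ae P, forall w, g w <= c}.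

(* Main.v *)
Require Import Defs.
From HB Require Import structures.
From mathcomp Require Import all_boot all_order all_algebra.
From mathcomp Require Import all_classical all_reals all_analysis.
From mathcomp Require Import measurable_realfun complex ring lra zify.
Import Order.TTheory GRing.Theory Num.Theory.
Import numFieldNormedType.Exports.

Local Open Scope classical_set_scope.
Local Open Scope ring_scope.

(** The smallest eigenvalue of the second moment matrix is the minimum over
    unit vectors a of the average of (a . f_t)^2.  Group the observations
    at multiples of d into blocks of a fixed length L.

    Within a block, fix a parameter and a direction: by successive conditioning
    ([prob_bigI_le]) all L projections are smaller than 2 eta with probability
    O(eta^(alpha L)).  Parameters and directions range over a bounded set, so a
    net of polynomial size ([bounded_set_net]) and a Lipschitz bound with
    integrable constant ([ae_lipschitz], [regular_process_envelope]) make this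
    uniform: for any p there is an L such that the minimum over all parameters
    and directions of the block sum of squares is below eta^2 with probability
    O(eta^p) ([small_ball_event]).  Taking p = 2 Q + 1 with an integer Q > q, the
    inverse Q-th power of that minimum has a measurable majorant with mean
    bounded uniformly in the block ([block_majorant]).

    The average over all times is at least a constant times the average of the
    block minima, and x |-> x^(-Q) is convex ([mean_inv_exprn_le]); hence the
    inverse power of the smallest eigenvalue is, uniformly in the parameter, at
    most 1 plus a constant times the average of the block majorants.  Taking
    expectations gives a bound independent of n. *)

(** * Euclidean norm and smallest eigenvalue *)

Section euclidean.
Set Implicit Arguments.
Unset Strict Implicit.
Context {R : realType}.

(** The Euclidean inner product of column vectors. *)
Definition edot (n : nat) (x y : 'cV[R]_n) : R := \sum_(i < n) x i ord0 * y i ord0.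

Lemma edotE n (x y : 'cV[R]_n) : (x^T *m y) ord0 ord0 = edot x y.
Proof. by rewrite mxE; apply: eq_bigr => i _; rewrite mxE. Qed.

Lemma edotC n (x y : 'cV[R]_n) : edot x y = edot y x.
Proof. by apply: eq_bigr => i _; rewrite mulrC. Qed.

Lemma edotDl n (x y z : 'cV[R]_n) : edot (x + y) z = edot x z + edot y z.
Proof. by rewrite -big_split /=; apply: eq_bigr => i _; rewrite mxE mulrDl. Qed.

Lemma edotZl n c (x z : 'cV[R]_n) : edot (c *: x) z = c * edot x z.
Proof. by rewrite mulr_sumr; apply: eq_bigr => i _; rewrite mxE mulrA. Qed.

Lemma edotBl n (x y z : 'cV[R]_n) : edot (x - y) z = edot x z - edot y z.
Proof. by rewrite -scaleN1r edotDl edotZl mulN1r. Qed.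

Lemma edotDr n (x y z : 'cV[R]_n) : edot z (x + y) = edot z x + edot z y.
Proof. by rewrite !(edotC z) edotDl. Qed.

Lemma edotBr n (x y z : 'cV[R]_n) : edot z (x - y) = edot z x - edot z y.
Proof. by rewrite !(edotC z) edotBl. Qed.

Lemma enorm_sqr n (x : 'cV[R]_n) : enorm x ^+ 2 = \sum_(i < n) x i ord0 ^+ 2.
Proof. by rewrite sqr_sqrtr// sumr_ge0// => i _; exact: sqr_ge0. Qed.

Lemma edotxx n (x : 'cV[R]_n) : edot x x = enorm x ^+ 2.
Proof. by rewrite enorm_sqr; apply: eq_bigr => i _; rewrite expr2. Qed.

Lemma enorm_ge0 n (x : 'cV[R]_n) : 0 <= enorm x.
Proof. exact: sqrtr_ge0. Qed.

Lemma enorm_eq0 n (x : 'cV[R]_n) : enorm x = 0 -> x = 0.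
Proof.
move=> x0; have : \sum_(i < n) x i ord0 ^+ 2 = 0 by rewrite -enorm_sqr x0 expr0n.
move/psumr_eq0P => h; apply/matrixP => i j; rewrite mxE (ord1 j).
by apply/eqP; rewrite -sqrf_eq0; apply/eqP/h => // ? _; exact: sqr_ge0.
Qed.

Lemma enormZ n c (x : 'cV[R]_n) : enorm (c *: x) = `|c| * enorm x.
Proof.
rewrite /enorm -sqrtr_sqr -sqrtrM ?sqr_ge0// mulr_sumr; congr Num.sqrt.
by apply: eq_bigr => i _; rewrite mxE exprMn.
Qed.

Lemma enormN n (x : 'cV[R]_n) : enorm (- x) = enorm x.
Proof. by rewrite -scaleN1r enormZ normrN1 mul1r. Qed.

Lemma cauchy_schwarz n (x y : 'cV[R]_n) : `|edot x y| <= enorm x * enorm y.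
Proof.
have [/enorm_eq0->|x0] := eqVneq (enorm x) 0.
  by rewrite -(scale0r 0) edotZl mul0r normr0 mulr_ge0// enorm_ge0.
have [/enorm_eq0->|y0] := eqVneq (enorm y) 0.
  by rewrite -(scale0r 0) edotC edotZl mul0r normr0 mulr_ge0// enorm_ge0.
have xy : 0 < enorm x * enorm y by rewrite mulr_gt0// lt0r enorm_ge0 ?x0 ?y0.
have key u : enorm u = enorm x -> edot u y <= enorm x * enorm y.
  move=> ux; rewrite -(ler_pM2l xy).
  have := sqr_ge0 (enorm (enorm y *: u - enorm x *: y)).
  rewrite -edotxx !(edotBl, edotBr) !edotZl !(edotC _ (_ *: _)) !edotZl !edotxx.
  rewrite ux (edotC y u).
  lra.
rewrite ler_norml key// andbT lerNl.
have -> : - edot x y = edot (- x) y by rewrite -[in RHS]scaleN1r edotZl mulN1r.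
by rewrite key// enormN.
Qed.

Lemma ler_enormD n (x y : 'cV[R]_n) : enorm (x + y) <= enorm x + enorm y.
Proof.
rewrite -(@ler_pXn2r _ 2)// ?nnegrE ?addr_ge0 ?enorm_ge0//.
rewrite -edotxx !(edotDl, edotDr) !edotxx (edotC y).
have := ler_norml (edot x y) (enorm x * enorm y); rewrite cauchy_schwarz.
by move/esym/andP => [_ h]; nra.
Qed.

Lemma enorm_subC n (x y : 'cV[R]_n) : enorm (x - y) = enorm (y - x).
Proof. by rewrite -enormN opprB. Qed.

Lemma enorm_trisub n (z x y : 'cV[R]_n) :
  enorm (x - y) <= enorm (x - z) + enorm (z - y).
Proof. by rewrite -[x - y](subrKA z) ler_enormD. Qed.

Lemma enorm_le n c (x : 'cV[R]_n) : (forall i, `|x i ord0| <= c) ->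
  enorm x <= n%:R * c.
Proof.
move=> h; have [n0|n0] := posnP n.
  by subst n; rewrite /enorm big_ord0 sqrtr0 mul0r.
have c0 : 0 <= c by apply: le_trans (h (Ordinal n0)).
rewrite -(@ler_pXn2r _ 2)// ?nnegrE ?mulr_ge0 ?enorm_ge0//.
rewrite enorm_sqr (@le_trans _ _ (\sum_(i < n) c ^+ 2))//.
  by apply: ler_sum => i _; rewrite -real_normK ?num_real// ler_pXn2r ?nnegrE.
rewrite sumr_const card_ord exprMn -[X in X <= _]mulr_natl ler_wpM2r ?sqr_ge0//.
by rewrite -natrX ler_nat; nia.
Qed.

Lemma ler_coord_enorm n (x : 'cV[R]_n) i : `|x i ord0| <= enorm x.
Proof.
rewrite -(@ler_pXn2r _ 2)// ?nnegrE ?enorm_ge0// enorm_sqr real_normK ?num_real//.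
by rewrite (bigD1 i)//= lerDl sumr_ge0// => j _; exact: sqr_ge0.
Qed.

(** Over R[i] the matrix has an eigenvalue z with eigenvector v; comparing
    v A v* with its conjugate, symmetry of A gives z = conj z, so z is real. *)
Lemma symmetric_real_eigenvalue n (A : 'M[R]_n) : (0 < n)%N -> A^T = A ->
  exists a, eigenvalue A a.
Proof.
move=> n0 sA; pose C := map_mx (real_complex R) A.
have [z zC] := eigenvalue_closed C n0.
have /eigenvalueP[v vC v0] := zC.
pose s : R[i] := \sum_i v ord0 i * Num.conj (v ord0 i).
have s0 : s != 0.
  apply: contra v0 => /eqP/psumr_eq0P h; apply/eqP/matrixP => i j.
  rewrite (ord1 i) mxE; apply/eqP; rewrite -mul_conjC_eq0; apply/eqP/h => //.
  by move=> k _; exact: mul_conjC_ge0.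
have AC i j : Num.conj (C i j) = C j i.
  by rewrite !mxE -[in RHS]sA mxE [LHS]conjc_real.
have zs : z * s = \sum_j \sum_i v ord0 i * C i j * Num.conj (v ord0 j).
  rewrite mulr_sumr; apply: eq_bigr => j _.
  by rewrite mulrA -mulr_suml; congr (_ * _);
    have /matrixP/(_ ord0 j) := vC; rewrite mxE [in RHS]mxE.
have sr : Num.conj s = s.
  by rewrite rmorph_sum; apply: eq_bigr => i _; rewrite rmorphM /= conjCK mulrC.
have : Num.conj (z * s) = z * s.
  rewrite zs rmorph_sum exchange_big /=; apply: eq_bigr => i _.
  rewrite rmorph_sum; apply: eq_bigr => j _.
  by rewrite !rmorphM /= conjCK AC mulrC mulrA mulrAC.
rewrite rmorphM /= sr => /(mulIf s0) zr.
have zE : z = real_complex R (complex.Re z).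
  by case: z zr {zC vC zs} => a b /= [] /eqP; rewrite eqNr => /eqP ->.
by exists (complex.Re z); rewrite -(eigenvalue_map (real_complex R)) -/C /= -zE.
Qed.

(** A lower bound on the quadratic form bounds every eigenvalue.  Existence of
    a real eigenvalue is needed because the infimum of the empty set is 0. *)
Lemma lambda_min_ge n (A : 'M[R]_n) c : (0 < n)%N -> A^T = A ->
  (forall a : 'cV[R]_n, c * enorm a ^+ 2 <= (a^T *m A *m a) ord0 ord0) ->
  c <= lambda_min A.
Proof.
move=> n0 sA h; apply: lb_le_inf.
  by have [a aA] := symmetric_real_eigenvalue n0 sA; exists a.
move=> x /= /eigenvalueP[v vA v0].
have vv : (v *m v^T) ord0 ord0 = enorm v^T ^+ 2 by rewrite -edotxx -edotE trmxK.
have := h v^T; rewrite trmxK vA -scalemxAl [X in _ <= X]mxE vv.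
rewrite ler_pM2r// exprn_gt0// lt0r enorm_ge0 andbT.
apply: contra v0 => /eqP/enorm_eq0 vt0.
by rewrite -[v]trmxK vt0 trmx0.
Qed.

Lemma second_moment_matrix_sym r (u : nat -> 'cV[R]_r) n :
  (second_moment_matrix u n)^T = second_moment_matrix u n.
Proof.
rewrite /second_moment_matrix linearZ/=; congr (_ *: _).
rewrite raddf_sum; apply: eq_bigr => t _ /=.
by rewrite trmx_mul trmxK.
Qed.

Lemma second_moment_quad r (u : nat -> 'cV[R]_r) n (a : 'cV[R]_r) :
  (a^T *m second_moment_matrix u n *m a) ord0 ord0 =
  n%:R^-1 * \sum_(1 <= t < n.+1) edot a (u t) ^+ 2.
Proof.
rewrite /second_moment_matrix -scalemxAr -scalemxAl mxE; congr (_ * _).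
rewrite mulmx_sumr mulmx_suml summxE; apply: eq_bigr => t _.
transitivity ((a^T *m u t *m ((u t)^T *m a)) ord0 ord0); first by rewrite !mulmxA.
by rewrite [LHS]mxE big_ord1 !edotE (edotC (u t)) expr2.
Qed.

End euclidean.

(** * Covering bounded sets *)

Section nets.
Set Implicit Arguments.
Unset Strict Implicit.
Context {R : realType}.

Lemma ler_coord_norm m (x : 'cV[R]_m) i : `|x i ord0| <= `|x|.
Proof.
rewrite [leRHS]mx_normrE.
exact: (le_bigmax_cond _ (fun ij => `|x ij.1 ij.2|) (isT : xpredT (i, ord0))).
Qed.

(** The covering number of a bounded set of dimension m at scale e is
    O(e^-m), with the centres taken in the set itself: cut a cube containing S
    into cells of side smaller than e / m and keep one point of S in each cell
    that S meets. *)
Lemma bounded_set_net m (S : set 'cV[R]_m) : bounded_set S ->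
  exists2 C, 0 < C & forall e, 0 < e -> e <= 1 -> exists s : seq 'cV[R]_m,
    [/\ forall x, x \in s -> S x, (size s)%:R <= C * e^-1 ^+ m
      & forall x, S x -> exists2 y, y \in s & enorm (x - y) < e].
Proof.
move=> [M [_ /(_ (`|M| + 1))]]; rewrite (le_lt_trans (ler_norm M)) ?ltrDl//.
move=> /(_ isT); set b := `|M| + 1 => Sb.
have b0 : 0 < b by rewrite /b ltr_pwDr.
exists ((2 * b * m.+1%:R + 1) ^+ m); first by rewrite exprn_gt0// ltr_pwDr// !mulr_ge0// ltW.
move=> e e0 e1.
pose h := e / m.+1%:R; have h0 : 0 < h by rewrite divr_gt0.
pose N := Num.trunc (2 * b / h).
pose cell (x : 'cV[R]_m) : {ffun 'I_m -> 'I_N.+1} :=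
  [ffun i => inord (Num.trunc ((x i ord0 + b) / h))].
have cellP x i : S x -> 0 <= (x i ord0 + b) / h /\
    cell x i = Num.trunc ((x i ord0 + b) / h) :> nat.
  move=> Sx; have := le_trans (ler_coord_norm x i) (Sb _ Sx).
  rewrite ler_norml => /andP[x1 x2].
  split; first by rewrite divr_ge0 ?(ltW h0)//; lra.
  rewrite ffunE inordK// ltnS le_truncn// ler_pM2r ?invr_gt0//; lra.
pose A c := [set x | S x /\ cell x = c].
(* One representative of each cell that meets S. *)
exists [seq xget 0 (A c) | c <- enum {ffun 'I_m -> 'I_N.+1} & `[< A c !=set0 >]].
have Ax c : A c !=set0 -> A c (xget 0 (A c)) by move=> [x Ax]; exact: xgetI Ax.
split.
- by move=> x /mapP[c]; rewrite mem_filter => /andP[/asboolP/Ax[]] ? _ _ ->.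
- rewrite size_map size_filter (@le_trans _ _ (N.+1 ^ m)%:R)//.
    rewrite ler_nat (leq_trans (count_size _ _))// -cardE card_ffun !card_ord//.
  rewrite natrX -exprMn lerXn2r ?nnegrE ?mulr_ge0 ?addr_ge0 ?mulr_ge0 ?invr_ge0
    ?(ltW e0) ?(ltW b0)//.
  have : N%:R <= 2 * b / h by rewrite truncn_le divr_ge0// ?(ltW h0)// mulr_ge0// ltW.
  rewrite -natr1 /h invf_div => hN.
  have : 1 <= e^-1 by rewrite invf_ge1.
  rewrite mulrDl mul1r; move: hN; rewrite !mulrA; lra.
- move=> x Sx; have Acx : A (cell x) !=set0 by exists x.
  exists (xget 0 (A (cell x))).
    apply/mapP; exists (cell x) => //.
    by rewrite mem_filter mem_enum andbT; apply/asboolP.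
  have [] := Ax _ Acx; set y := xget _ _ => Sy yx.
  apply: (@le_lt_trans _ _ (m%:R * h)); last first.
    by rewrite /h mulrA ltr_pdivrMr// mulrC ltr_pM2l// ltr_nat.
  apply: enorm_le => i; rewrite !mxE.
  have [x1 x2] := cellP x i Sx; have [y1 y2] := cellP y i Sy.
  have /andP[] := truncn_itv x1; rewrite -x2 -yx y2.
  have /andP[] := truncn_itv y1.
  rewrite ler_norml -natr1 !(ler_pdivlMr _ _ h0, ltr_pdivrMr _ _ h0).
  lra.
Qed.

End nets.

(** * Almost sure Lipschitz continuity *)

Section ae_lip.
Set Implicit Arguments.
Unset Strict Implicit.
Context {R : realType}.

Lemma ler_norm_enorm m (x : 'cV[R]_m) : `|x| <= enorm x.
Proof.
rewrite [leLHS]mx_normrE; apply: bigmax_le; first exact: enorm_ge0.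
by move=> [i j] _ /=; rewrite (ord1 j) ler_coord_enorm.
Qed.

Lemma within_continuous_enorm k r (S : set 'cV[R]_k) (h : 'cV[R]_k -> 'cV[R]_r) x e :
  {within S, continuous h} -> S x -> 0 < e ->
  exists2 eta, 0 < eta &
    forall y, S y -> enorm (x - y) < eta -> enorm (h x - h y) < e.
Proof.
move=> /subspace_continuousP/[apply] hx e0.
have e1 : 0 < e / r.+1%:R by rewrite divr_gt0.
have /= := cvgr_dist_lt _ _ hx _ e1.
move=> /(_ (within_filter _ _)); rewrite near_withinE => /nbhs_ballP[eta /= eta0 heta].
exists eta => // y Sy xy.
have : `|h x - h y| < e / r.+1%:R.
  by apply: heta => //; rewrite -ball_normE /=; exact: le_lt_trans (ler_norm_enorm _) xy.
rewrite ltr_pdivlMr// mulrC; apply: le_lt_trans.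
apply: le_trans (enorm_le (fun i => ler_coord_norm _ i)) _.
by rewrite ler_wpM2r// ler_nat.
Qed.

(** A Lipschitz bound that holds almost surely for each pair of points holds
    almost surely for all pairs at once: it suffices to have it on a countable
    dense subset, by continuity of the sample paths. *)
Lemma ae_lipschitz (d : measure_display) (T : measurableType d)
    (P : {measure set T -> \bar R}) k r (S : set 'cV[R]_k)
    (g : 'cV[R]_k -> T -> 'cV[R]_r) (B : T -> R) tau :
  bounded_set S -> (forall w, {within S, continuous (fun x => g x w)}) ->
  (forall w, 0 <= B w) ->
  (forall x y, S x -> S y -> enorm (x - y) < tau ->
    {ae P, forall w, enorm (g x w - g y w) <= B w * enorm (x - y)}) ->
  {ae P, forall w, forall x y, S x -> S y -> enorm (x - y) < tau ->
    enorm (g x w - g y w) <= B w * enorm (x - y)}.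
Proof.
move=> /bounded_set_net[C C0 net] cg B0 lip.
have /choice[D DS] : forall n : nat, exists s : seq 'cV[R]_k, (forall x, x \in s -> S x) /\
    forall x, S x -> exists2 y, y \in s & enorm (x - y) < n.+1%:R^-1.
  move=> n; have e0 : 0 < n.+1%:R^-1 :> R by rewrite invr_gt0.
  have e1 : n.+1%:R^-1 <= 1 :> R by rewrite invf_le1// ler1n.
  by have [s [? _ ?]] := net _ e0 e1; exists s.
(* The dense subset is the union of the nets D n of mesh 1 / (n + 1). *)
have H : {ae P, forall w, forall n i m j, (i < size (D n))%N -> (j < size (D m))%N ->
   enorm (nth 0 (D n) i - nth 0 (D m) j) < tau ->
   enorm (g (nth 0 (D n) i) w - g (nth 0 (D m) j) w) <=
     B w * enorm (nth 0 (D n) i - nth 0 (D m) j)}.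
  apply: ae_foralln => n; apply: ae_foralln => i.
  apply: ae_foralln => m; apply: ae_foralln => j.
  have [si|?] := ltnP i (size (D n)); last by apply: aeW.
  have [sj|?] := ltnP j (size (D m)); last by apply: aeW.
  have [xy|?] := ltP (enorm (nth 0 (D n) i - nth 0 (D m) j)) tau; last by apply: aeW.
  have := lip _ _ ((DS n).1 _ (mem_nth 0 si)) ((DS m).1 _ (mem_nth 0 sj)) xy.
  by apply: filterS => w hw _ _ _.
apply: filterS H => w Hw x y Sx Sy xy.
have near x' e : S x' -> 0 < e -> exists n i, [/\ (i < size (D n))%N,
    enorm (x' - nth 0 (D n) i) < e & enorm (g x' w - g (nth 0 (D n) i) w) < e].
  move=> Sx' e0.
  have [eta eta0 heta] := within_continuous_enorm (cg w) Sx' e0.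
  pose n := Num.trunc (Num.min e eta)^-1; exists n.
  have mn : n.+1%:R^-1 < Num.min e eta.
    by rewrite invf_plt ?posrE ?lt_min ?e0// truncnS_gt.
  have [z zD xz] := (DS n).2 _ Sx'.
  have xz' := lt_trans xz mn; move: (xz'); rewrite lt_min => /andP[xz1 xz2].
  exists (index z (D n)); rewrite index_mem nth_index//; split => //.
  by apply: heta => //; exact: (DS n).1.
apply/ler_addgt0Pr => e e0.
have Bw := B0 w.
(* Accuracy small enough to keep the approximating points closer than tau, and
   for the total error a * (2 + 2 * B w) to be at most e. *)
pose a := Num.min ((tau - enorm (x - y)) / 3) (e / (2 + 2 * B w)).
have a0 : 0 < a.
  by rewrite lt_min !divr_gt0 ?subr_gt0// ltr_wpDr// mulr_ge0.
have [n [i [si xi gi]]] := near x a Sx a0.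
have [m [j [sj yj gj]]] := near y a Sy a0.
have := Hw n i m j si sj.
move: (nth 0 (D n) i) (nth 0 (D m) j) xi gi yj gj => x' y' xi gi yj gj.
have a1 : a <= (tau - enorm (x - y)) / 3 by rewrite ge_min lexx.
have a2 : a * (2 + 2 * B w) <= e.
  by rewrite -ler_pdivlMr ?ltr_wpDr ?mulr_ge0// ge_min lexx orbT.
have d1 : enorm (x' - y') <= enorm (x - y) + a + a.
  apply: le_trans (enorm_trisub x _ _) _; rewrite enorm_subC.
  apply: le_trans (lerD (lexx _) (enorm_trisub y _ _)) _; lra.
have d2 : enorm (g x w - g y w) <= enorm (g x' w - g y' w) + a + a.
  apply: le_trans (enorm_trisub (g x' w) _ _) _.
  apply: le_trans (lerD (lexx _) (enorm_trisub (g y' w) _ _)) _.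
  rewrite [enorm (g y' w - _)]enorm_subC; lra.
move=> h.
have h1 : enorm (g x' w - g y' w) <= B w * enorm (x' - y') by apply: h => //; lra.
have h2 : B w * enorm (x' - y') <= B w * (enorm (x - y) + a + a) by rewrite ler_wpM2l.
lra.
Qed.

End ae_lip.

(** * Conditional probabilities *)

Section conditioning.
Set Implicit Arguments.
Unset Strict Implicit.
Context {d : measure_display} {T : measurableType d} {R : realType}.
Variable P : probability T R.

Lemma sigma_algebra_measurable (G : set (set T)) (A : set T) :
  sigma_algebra setT G ->
  G A <-> measurable (A : set (g_sigma_algebraType G)).
Proof. by move=> sG; rewrite -[in X in X <-> _](sigma_algebra_id sG). Qed.

(** Integrating P(A | G) <= c over an event of G. *)
Lemma cond_prob_leI (G : set (set T)) (A D : set T) c : 0 <= c ->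
  G `<=` measurable -> cond_prob_le P G A c -> G D ->
  (P (A `&` D) <= c%:E * P D)%E.
Proof.
move=> c0 Gm [g [mg ig gP] gc] GD; have mD := Gm _ GD.
rewrite -gP//.
have mgD : measurable_fun D (EFin \o g).
  by apply: measurable_funS (measurable_int _ ig).
(* The version g of the conditional probability may be negative on a null set. *)
apply: (@le_trans _ _ (\int[P]_(w in D) ((EFin \o g)^\+ w))%E).
  by rewrite integralE -[leRHS]sube0 leeB// integral_ge0.
rewrite -integral_cst//; apply: ae_ge0_le_integral => //=.
- exact: measurable_funepos.
- by apply: filterS gc => w gw _; rewrite funeposE ge_max !lee_fin gw.
Qed.

(** Successive conditioning: L events, each of conditional probability at
    most c given the past, occur simultaneously with probability at most c^L. *)
Lemma prob_bigI_le (G : nat -> set (set T)) (A : nat -> set T) c L : 0 <= c ->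
  (forall l, sigma_algebra setT (G l)) -> (forall l, G l `<=` measurable) ->
  (forall l, G l `<=` G l.+1) -> (forall l, G l.+1 (A l)) ->
  (forall l, cond_prob_le P (G l) (A l) c) ->
  (P (\big[setI/setT]_(l < L) A l) <= (c ^+ L)%:E)%E.
Proof.
move=> c0 sG Gm Gmono GA Pc.
have GI n : G n (\big[setI/setT]_(l < n) A l).
  elim: n => [|n IH]; first rewrite big_ord0.
    by apply/(sigma_algebra_measurable _ (sG _)); exact: measurableT.
  rewrite big_ord_recr /=; apply/(sigma_algebra_measurable _ (sG _)).
  apply: measurableI; apply/(sigma_algebra_measurable _ (sG _)) => //.
  exact: Gmono.
elim: L => [|L IH]; first by rewrite big_ord0 probability_setT expr0.
rewrite big_ord_recr /= setIC.
apply: le_trans (cond_prob_leI c0 (Gm L) (Pc L) (GI L)) _.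
by rewrite exprS EFinM lee_wpmul2l.
Qed.

Lemma measurable_edot (G : set (set T)) r (a : 'cV[R]_r) (g : T -> 'cV[R]_r) :
  (forall i, measurable_wrt G (fun w => g w i ord0)) ->
  measurable_wrt G (fun w => edot a (g w)).
Proof.
move=> mg; apply: measurable_sum => i.
by apply: measurable_funM => //; exact: mg.
Qed.

Lemma slab_in_sigma_algebra (G : set (set T)) r (a : 'cV[R]_r) (g : T -> 'cV[R]_r) s1 s2 :
  sigma_algebra setT G ->
  (forall i, measurable_wrt G (fun w => g w i ord0)) ->
  G [set w | s1 < (a^T *m g w) ord0 ord0 <= s2].
Proof.
move=> sG mg; apply/(sigma_algebra_measurable _ sG).
have := measurable_edot a mg measurableT (measurable_itv `]s1, s2]); rewrite setTI.
congr measurable; apply/seteqP; split => w /=; by rewrite in_itv/= edotE.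
Qed.

Lemma measurable_wrtW (G : set (set T)) (g : T -> R) : sigma_algebra setT G ->
  G `<=` measurable -> measurable_wrt G g -> measurable_fun setT g.
Proof.
move=> sG Gm mg _ Y mY; apply: Gm; apply/(sigma_algebra_measurable _ sG).
exact: mg.
Qed.

(** Neither function need be measurable: the integral of a nonnegative
    function is a supremum over the simple functions below it.  This is how the
    supremum over the parameter is integrated without proving that it is
    measurable. *)
Lemma le_integral_nonmeasurable (f h : T -> \bar R) :
  (forall w, 0 <= h w)%E -> (forall w, f w <= h w)%E ->
  (\int[P]_w f w <= \int[P]_w h w)%E.
Proof.
move=> h0 fh.
apply: (@le_trans _ _ (\int[P]_w (f^\+ w))%E).
  by rewrite integralE -[leRHS]sube0 leeB// integral_ge0.
rewrite !ge0_integralTE//; apply: le_ereal_sup => _ [g gf <-].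
exists g => // w; apply: le_trans (gf w) _.
by rewrite funeposE ge_max fh h0.
Qed.

End conditioning.

(** * Union bound and Markov's inequality *)

Section bounds.
Set Implicit Arguments.
Unset Strict Implicit.
Context {d : measure_display} {T : measurableType d} {R : realType}.
Variable P : probability T R.

Lemma prob_bigcup_seq_le (I : choiceType) (s : seq I) (A : I -> set T) c :
  (forall x, x \in s -> measurable (A x)) ->
  (forall x, x \in s -> P (A x) <= c%:E)%E ->
  measurable (\bigcup_(x in [set` s]) A x) /\
  (P (\bigcup_(x in [set` s]) A x) <= ((size s)%:R * c)%:E)%E.
Proof.
rewrite bigcup_seq; elim: s => [|x s IH] mA Ac.
  by rewrite big_nil measure0 mul0r; split.
have [mU PU] : measurable (\big[setU/set0]_(y <- s) A y) /\
    (P (\big[setU/set0]_(y <- s) A y) <= ((size s)%:R * c)%:E)%E.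
  by apply: IH => y ys; [apply: mA|apply: Ac]; rewrite inE ys orbT.
have xs : x \in x :: s by rewrite inE eqxx.
rewrite big_cons; split; first by apply: measurableU => //; exact: mA.
apply: le_trans (measureU2 P (mA _ xs) mU) _.
by rewrite /= -nat1r mulrDl mul1r EFinD leeD// Ac.
Qed.

(** Markov's inequality for a nonnegative function. *)
Lemma prob_ge_le (W : T -> R) c y : measurable_fun setT W ->
  (forall w, 0 <= W w) -> (\int[P]_w (W w)%:E <= c%:E)%E -> 0 < y ->
  measurable [set w | y <= W w] /\ (P [set w | (y <= W w)%R] <= (c / y)%:E)%E.
Proof.
move=> mW W0 Wc y0.
have mA : measurable [set w | y <= W w].
  have := mW measurableT _ (measurable_itv `[y, +oo[); rewrite setTI.
  by congr measurable; apply/seteqP; split => w /=; rewrite in_itv/= andbT.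
split=> //; rewrite EFinM lee_pdivlMr// muleC; apply: le_trans Wc.
set A := [set w | _] in mA *.
have mi : measurable_fun setT (fun w => (\1_A w)%:E : \bar R).
  by apply/measurable_EFinP; exact: measurable_indic.
have <- : (\int[P]_w (y%:E * (\1_A w)%:E) = y%:E * P A)%E.
  rewrite ge0_integralZl_EFin//; last exact: ltW.
  by rewrite integral_indic ?setIT.
apply: ge0_le_integral => //.
- by move=> w _; rewrite -EFinM lee_fin mulr_ge0// ltW.
- exact: measurable_funeM.
- exact/measurable_EFinP.
move=> w _; rewrite -EFinM lee_fin indicE.
by have [/set_mem Aw|_] := boolP (w \in A); rewrite ?mulr0// mulr1.
Qed.

Lemma sphere_bounded r : bounded_set [set a : 'cV[R]_r | enorm a = 1].
Proof.
exists 1; split; first exact: num_real.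
by move=> y y1 x /= x1; rewrite (le_trans (ler_norm_enorm x))// x1 ltW.
Qed.

End bounds.

(** * Integrable envelope *)

Section envelope.
Set Implicit Arguments.
Unset Strict Implicit.
Context {d : measure_display} {T : measurableType d} {R : realType}.
Variable P : probability T R.

Lemma integral_EFinD_le (h1 h2 : T -> R) c1 c2 :
  measurable_fun setT h1 -> measurable_fun setT h2 ->
  (forall w, 0 <= h1 w) -> (forall w, 0 <= h2 w) ->
  (\int[P]_w (h1 w)%:E <= c1%:E)%E -> (\int[P]_w (h2 w)%:E <= c2%:E)%E ->
  (\int[P]_w (h1 w + h2 w)%:E <= (c1 + c2)%:E)%E.
Proof.
move=> m1 m2 h1_ge0 h2_ge0 i1 i2; under eq_integral do rewrite EFinD.
have h1_ge0' w : setT w -> (0 <= (h1 w)%:E)%E by rewrite lee_fin.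
have h2_ge0' w : setT w -> (0 <= (h2 w)%:E)%E by rewrite lee_fin.
have m1' : measurable_fun setT (EFin \o h1) by exact/measurable_EFinP.
have m2' : measurable_fun setT (EFin \o h2) by exact/measurable_EFinP.
by rewrite ge0_integralD// EFinD leeD.
Qed.

Lemma integral_EFinZ_le (h : T -> R) a c : 0 <= a ->
  measurable_fun setT h -> (forall w, 0 <= h w) ->
  (\int[P]_w (h w)%:E <= c%:E)%E -> (\int[P]_w (a * h w)%:E <= (a * c)%:E)%E.
Proof.
move=> a0 mh h0 i; under eq_integral do rewrite EFinM.
have h0' w : setT w -> (0 <= (h w)%:E)%E by rewrite lee_fin.
have mh' : measurable_fun setT (EFin \o h) by exact/measurable_EFinP.
by rewrite ge0_integralZl_EFin// EFinM lee_wpmul2l.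
Qed.

Lemma integral_sum_seq_le (I : eqType) (s : seq I) (h : I -> T -> R) c :
  (forall x, x \in s -> measurable_fun setT (h x)) ->
  (forall x w, x \in s -> 0 <= h x w) ->
  (forall x, x \in s -> \int[P]_w (h x w)%:E <= c%:E)%E ->
  measurable_fun setT (fun w => \sum_(x <- s) h x w) /\
  (\int[P]_w (\sum_(x <- s) h x w)%:E <= ((size s)%:R * c)%:E)%E.
Proof.
elim: s => [|x s IH] mh h0 hc.
  under eq_fun do rewrite big_nil; under eq_integral do rewrite big_nil.
  by rewrite integral0 mul0r; split.
have [mU PU] : measurable_fun setT (fun w => \sum_(y <- s) h y w) /\
    (\int[P]_w (\sum_(y <- s) h y w)%:E <= ((size s)%:R * c)%:E)%E.
  apply: IH => [y ys|y w ys|y ys]; [apply: mh|apply: h0|apply: hc];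
    by rewrite inE ys orbT.
have xs : x \in x :: s by rewrite inE eqxx.
under eq_fun do rewrite big_cons; under eq_integral do rewrite big_cons.
split; first by apply: measurable_funD => //; exact: mh.
rewrite /= -nat1r mulrDl mul1r; apply: integral_EFinD_le => //.
- exact: mh.
- by move=> w; apply: h0.
- by move=> w; rewrite big_seq sumr_ge0// => y ys; apply: h0; rewrite inE ys orbT.
- exact: hc.
Qed.

(** The properties of the observations that matter for one block: u l x w is
    the l-th observation at the parameter x, and G l is the information
    available before it, so that u l is adapted to G l.+1 and its projections
    are not concentrated given G l.  The constants are shared by all blocks,
    which makes the bounds below uniform in the block. *)
Record regular_process k r (S : set 'cV[R]_k) (delta alpha M tau C1 C2 : R)
  (G : nat -> set (set T)) (u : nat -> 'cV[R]_k -> T -> 'cV[R]_r)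
  (B : nat -> T -> R) : Prop := RegularProcess {
  rp_sigma : forall l, sigma_algebra setT (G l);
  rp_measurable : forall l, G l `<=` measurable;
  rp_mono : forall l, G l `<=` G l.+1;
  rp_adapted : forall l x, S x ->
    forall i, measurable_wrt (G l.+1) (fun w => u l x w i ord0);
  rp_slab : forall l s1 s2 x a, 0 < s2 - s1 -> s2 - s1 <= delta -> S x ->
    enorm a = 1 ->
    cond_prob_le P (G l) [set w | s1 < (a^T *m u l x w) ord0 ord0 <= s2]
      (M * (s2 - s1) `^ alpha);
  rp_B_ge0 : forall l w, 0 <= B l w;
  rp_B_measurable : forall l, measurable_fun setT (B l);
  rp_B_mean : forall l, (\int[P]_w (B l w)%:E <= C1%:E)%E;
  rp_lipschitz : forall l, {ae P, forall w, forall x y, S x -> S y ->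
    enorm (x - y) < tau -> enorm (u l x w - u l y w) <= B l w * enorm (x - y)};
  rp_second_moment : forall l x, S x ->
    (\int[P]_w (enorm (u l x w) ^+ 2)%:E <= C2%:E)%E }.

(** A single integrable variable W dominates u l x plus the Lipschitz constant
    simultaneously for all x in S.  Take a finite net s of S of mesh less than
    tau; every u l x is within tau * B l of some u l y with y in s, and
    enorm (u l y) <= 1 + enorm (u l y) ^+ 2, so that
    W := \sum_(y <- s) (1 + enorm (u l y) ^+ 2) + (tau + 1) * B l will do. *)
Lemma regular_process_envelope k r (S : set 'cV[R]_k) delta alpha M tau C1 C2 :
  bounded_set S -> 0 < tau -> 0 < C1 -> 0 < C2 ->
  exists2 CW, 0 < CW &
  forall G (u : nat -> 'cV[R]_k -> T -> 'cV[R]_r) B,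
  regular_process S delta alpha M tau C1 C2 G u B ->
  forall l, exists W : T -> R, [/\ measurable_fun setT W, forall w, 0 <= W w,
    (\int[P]_w (W w)%:E <= CW%:E)%E &
    forall w, (forall x y, S x -> S y -> enorm (x - y) < tau ->
        enorm (u l x w - u l y w) <= B l w * enorm (x - y)) ->
      forall x, S x -> enorm (u l x w) + B l w <= W w].
Proof.
move=> /bounded_set_net[C C0 net] tau0 C10 C20.
have [] := net (Num.min 1 tau); first by rewrite lt_min ltr01.
  by rewrite ge_min lexx.
move=> s [sS _ scover].
exists ((size s)%:R * (1 + C2) + (tau + 1) * C1).
  by rewrite ltr_wpDl ?mulr_ge0 ?mulr_gt0 ?addr_gt0// ltW// addr_gt0.
move=> G u B reg l.
have mu x : S x -> measurable_fun setT (fun w => enorm (u l x w) ^+ 2).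
  move=> Sx; under eq_fun do rewrite enorm_sqr.
  apply: measurable_sum => i; apply: measurable_funX.
  apply: (measurable_wrtW (rp_sigma reg l.+1) _ (rp_adapted reg Sx i)).
  exact: rp_measurable reg _.
have B0 := rp_B_ge0 reg l; have mB := rp_B_measurable reg l.
have h1 x : S x -> (\int[P]_w (1 + enorm (u l x w) ^+ 2)%:E <= (1 + C2)%:E)%E.
  move=> Sx; apply: integral_EFinD_le => //.
  - exact: mu.
  - by move=> w; exact: sqr_ge0.
  - by rewrite integral_cst// mul1e probability_le1.
  - exact: rp_second_moment reg _ _ Sx.
have [|||mW iW] := @integral_sum_seq_le _ s (fun x w => 1 + enorm (u l x w) ^+ 2) (1 + C2).
- by move=> x xs; apply: measurable_funD => //; apply: mu; exact: sS.
- by move=> x w _; rewrite addr_ge0// sqr_ge0.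
- by move=> x xs; apply: h1; exact: sS.
have Wge0 w : 0 <= \sum_(x <- s) (1 + enorm (u l x w) ^+ 2).
  by rewrite sumr_ge0// => x _; rewrite addr_ge0// sqr_ge0.
have t1 : 0 <= tau + 1 by rewrite addr_ge0// ltW.
exists (fun w => \sum_(x <- s) (1 + enorm (u l x w) ^+ 2) + (tau + 1) * B l w); split.
- by apply: measurable_funD => //; exact: measurable_funM.
- by move=> w; rewrite addr_ge0// mulr_ge0.
- apply: integral_EFinD_le => //.
  + exact: measurable_funM.
  + by move=> w; rewrite mulr_ge0.
  + by apply: integral_EFinZ_le => //; exact: rp_B_mean reg _.
move=> w lip x Sx.
have [y ys xy] := scover _ Sx; move: xy; rewrite lt_min => /andP[_ xy].
have h2 : enorm (u l x w) <= enorm (u l y w) + B l w * tau.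
  rewrite -[u l x w](subrK (u l y w)) (le_trans (ler_enormD _ _))// addrC lerD2l.
  by rewrite (le_trans (lip _ _ Sx (sS _ ys) xy))// ler_wpM2l// ltW.
have h3 : 1 + enorm (u l y w) ^+ 2 <= \sum_(x <- s) (1 + enorm (u l x w) ^+ 2).
  rewrite (big_rem y)//= lerDl sumr_ge0// => z _.
  by rewrite addr_ge0// sqr_ge0.
have := sqr_ge0 (enorm (u l y w) - 1); have := enorm_ge0 (u l y w).
nra.
Qed.

End envelope.

(** * Small-ball estimate for one block *)

Section level.
Set Implicit Arguments.
Unset Strict Implicit.
Context {d : measure_display} {T : measurableType d} {R : realType}.
Variable P : probability T R.

Lemma powR_exprn_le (eta alpha : R) (N L : nat) : 0 < eta -> eta <= 1 ->
  N%:R <= alpha * L%:R -> (eta `^ alpha) ^+ L <= eta ^+ N.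
Proof.
move=> e0 e1 NL.
rewrite -powR_mulrn ?powR_ge0// -powRrM -powR_mulrn ?(ltW e0)//.
by apply: ger_powR; rewrite // e0.
Qed.

(** If a unit vector a is nearly orthogonal to x, then so is every vector b
    near a to every vector y near x. *)
Lemma slab_perturbation r (a b x y : 'cV[R]_r) e eta : enorm a = 1 ->
  `|edot a x| < eta -> enorm (a - b) <= e -> enorm (x - y) + e * enorm y <= eta ->
  `|edot b y| < 2 * eta.
Proof.
move=> a1 ax ab xy.
have -> : edot b y = edot a x - edot a (x - y) - edot (a - b) y.
  by rewrite edotBr edotBl; ring.
apply: le_lt_trans (ler_normB _ _) _.
apply: le_lt_trans (lerD (ler_normB _ _) (lexx _)) _.
have := cauchy_schwarz a (x - y); rewrite a1 mul1r.
have := cauchy_schwarz (a - b) y.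
have : enorm (a - b) * enorm y <= e * enorm y by rewrite ler_wpM2r// enorm_ge0.
lra.
Qed.

(** Polynomial small-ball estimate, uniform in the parameter.  Outside an event
    of probability O(eta^p) the sum of L squared projections is at least
    eta^2 for all parameters and all unit directions at once.  The exceptional event
    is the union of a null set, of {W l >= eta / e} for l < L (Markov), and, for
    each point of a net of mesh e of the parameters times the unit sphere, of the
    event that all L projections are at most 2 eta (probability O(eta^(alpha L))).
    With e = eta^(p+1) the net has O(eta^-((p+1)(k+r))) points, and L is chosen
    to beat this number. *)
Lemma small_ball_event k r (S : set 'cV[R]_k) delta alpha M tau C1 C2 (p : nat) :
  bounded_set S -> 0 < alpha -> 0 < M -> 0 < tau -> 0 < C1 -> 0 < C2 ->
  exists L C, [/\ (0 < L)%N, 0 < C &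
  forall G (u : nat -> 'cV[R]_k -> T -> 'cV[R]_r) B,
  regular_process P S delta alpha M tau C1 C2 G u B ->
  forall eta, 0 < eta -> eta <= 1 -> 4 * eta <= delta -> 2 * eta <= tau ->
  exists E : set T, [/\ measurable E, (P E <= (C * eta ^+ p)%:E)%E &
    forall w, ~ E w -> forall x (a : 'cV[R]_r), S x ->
      eta ^+ 2 * enorm a ^+ 2 <= \sum_(l < L) edot a (u l x w) ^+ 2]].
Proof.
move=> bS alpha0 M0 tau0 C10 C20.
have [CW CW0 env] := @regular_process_envelope _ _ _ P k r S delta alpha M tau C1 C2 bS tau0 C10 C20.
have [CS CS0 netS] := bounded_set_net bS.
have [CA CA0 netA] := bounded_set_net (@sphere_bounded R r).
(* N is the exponent needed from successive conditioning; alpha * L >= N. *)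
pose N := (p.+1 * (k + r) + p)%N.
pose L := (Num.trunc (N%:R / alpha)).+1.
have NL : N%:R <= alpha * L%:R.
  by rewrite mulrC -ler_pdivrMr// ltW// truncnS_gt.
pose c4 := M * 4 `^ alpha.
have c40 : 0 < c4 by rewrite mulr_gt0// powR_gt0.
exists L, (L%:R * CW + CS * CA * c4 ^+ L); split => //.
  by rewrite addr_gt0 ?mulr_gt0 ?exprn_gt0 ?mulr_gt0 ?ltr0n.
move=> G u B reg eta eta0 eta1 eta_delta eta_tau.
pose e := eta ^+ p.+1.
have e0 : 0 < e by rewrite exprn_gt0.
have e_eta : e <= eta by rewrite /e exprS ler_piMr ?exprn_ile1// ltW.
have e1 : e <= 1 := le_trans e_eta eta1.
have [sS [sSS szS coverS]] := netS e e0 e1.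
have [sA [sAA szA coverA]] := netA e e0 e1.
have /choice[W HW] := env G u B reg.
have [N0 [mN0 PN0 N0P]] := ae_foralln (rp_lipschitz reg).
pose slab l x (a : 'cV[R]_r) := [set w | - (2 * eta) < (a^T *m u l x w) ord0 ord0 <= 2 * eta].
pose Q x a := \bigcap_(l < L) slab l x a.
pose E1 := \bigcup_(l in [set` iota 0 L]) [set w | eta / e <= W l w].
pose E2 := \bigcup_(x in [set` sS]) \bigcup_(a in [set` sA]) Q x a.
have [mE1 PE1] : measurable E1 /\ (P E1 <= (L%:R * (CW / (eta / e)))%:E)%E.
  rewrite -[in L%:R](size_iota 0 L).
  apply: prob_bigcup_seq_le => l _; have [mW W0 iW _] := HW l;
    by have [] := prob_ge_le mW W0 iW (divr_gt0 eta0 e0).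
have [mE2 PE2] : measurable E2 /\
   (P E2 <= ((size sS)%:R * ((size sA)%:R * (M * (4 * eta) `^ alpha) ^+ L))%:E)%E.
  have inner x : x \in sS -> measurable (\bigcup_(a in [set` sA]) Q x a) /\
      (P (\bigcup_(a in [set` sA]) Q x a) <=
        ((size sA)%:R * (M * (4 * eta) `^ alpha) ^+ L)%:E)%E.
    move=> /sSS Sx; apply: prob_bigcup_seq_le => a /sAA a1.
      rewrite /Q; apply: bigcap_measurable => [|l _]; first by exists 0%N.
      apply: (rp_measurable reg (l := l.+1)).
      exact: slab_in_sigma_algebra (rp_sigma reg _) (rp_adapted reg Sx).
    rewrite /Q bigcap_mkord; apply: (prob_bigI_le (G := G) (A := fun l => slab l x a)).
    - by rewrite mulr_ge0// ?powR_ge0// ltW.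
    - exact: rp_sigma reg.
    - exact: rp_measurable reg.
    - exact: rp_mono reg.
    - move=> l; exact: slab_in_sigma_algebra (rp_sigma reg _) (rp_adapted reg Sx).
    - move=> l; have -> : 4 * eta = 2 * eta - - (2 * eta) by ring.
      apply: rp_slab reg _ _ _ _ _ _ _ Sx a1; lra.
  by apply: prob_bigcup_seq_le => x /inner[].
exists (N0 `|` (E1 `|` E2)); split.
- by apply: measurableU => //; exact: measurableU.
- apply: le_trans (measureU2 P mN0 (measurableU _ _ mE1 mE2)) _.
  rewrite [X in (X + _)%E]PN0 add0e.
  apply: le_trans (measureU2 P mE1 mE2) _.
  apply: le_trans (leeD PE1 PE2) _.
  rewrite -EFinD lee_fin [leRHS]mulrDl; apply: lerD.
    rewrite /e exprS invf_div -!mulrA ler_wpM2l// ler_wpM2l ?(ltW CW0)//.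
    by rewrite mulrA mulrAC divff ?mul1r// gt_eqF.
  have h1 : (M * (4 * eta) `^ alpha) ^+ L <= c4 ^+ L * eta ^+ N.
    rewrite powRM ?(ltW eta0)// mulrA -/c4 exprMn ler_wpM2l ?exprn_ge0 ?(ltW c40)//.
    exact: powR_exprn_le.
  have h2 : (size sA)%:R * (M * (4 * eta) `^ alpha) ^+ L <=
      (CA * e^-1 ^+ r) * (c4 ^+ L * eta ^+ N).
    by apply: ler_pM => //; rewrite exprn_ge0// mulr_ge0 ?powR_ge0// ltW.
  apply: (@le_trans _ _ ((CS * e^-1 ^+ k) * ((CA * e^-1 ^+ r) * (c4 ^+ L * eta ^+ N)))).
    apply: ler_pM => //.
    by rewrite mulr_ge0// exprn_ge0// mulr_ge0 ?powR_ge0// ltW.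
  rewrite le_eqVlt; apply/orP; left; apply/eqP.
  have -> : eta ^+ N = e ^+ k * e ^+ r * eta ^+ p.
    by rewrite /N exprD /e -!exprM mulnDr exprD.
  rewrite !exprVn; field.
  by rewrite !expf_neq0// gt_eqF.
move=> w /not_orP[wN0 /not_orP[wE1 wE2]] x a Sx.
have lip : forall l x y, S x -> S y -> enorm (x - y) < tau ->
    enorm (u l x w - u l y w) <= B l w * enorm (x - y).
  by apply: contrapT => h; apply: wN0; exact: N0P.
(* If the sum were small at (x, b), then at a point (y, c) of the net within e of
   it all the projections would be below 2 eta. *)
have unit_case b : enorm b = 1 -> eta ^+ 2 <= \sum_(l < L) edot b (u l x w) ^+ 2.
  move=> b1; rewrite leNgt; apply/negP => small; apply: wE2.
  have [y ysS xy] := coverS _ Sx; have [c csA bc] := coverA _ b1.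
  exists y => //; exists c => // l lL.
  rewrite /slab /= edotE.
  suff : `|edot c (u l y w)| < 2 * eta.
    by rewrite ltr_norml => /andP[-> /ltW ->].
  have Wl : W l w < eta / e.
    rewrite ltNge; apply/negP => h; apply: wE1; exists l => //; rewrite /mkset mem_iota.
    by rewrite leq0n add0n.
  have [_ _ _ /(_ w (lip l) _ (sSS _ ysS)) hW] := HW l.
  have b_small : `|edot b (u l x w)| < eta.
    rewrite -(@ltr_pXn2r _ 2)// ?nnegrE ?(ltW eta0)//.
    apply: le_lt_trans small; rewrite real_normK ?num_real//.
    rewrite (bigD1 (Ordinal lL))//= lerDl sumr_ge0// => j _; exact: sqr_ge0.
  apply: (slab_perturbation b1 b_small (ltW bc)).
  have xyt : enorm (x - y) < tau by lra.
  have := lip l x y Sx (sSS _ ysS) xyt.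
  have : B l w * enorm (x - y) <= B l w * e.
    by rewrite ler_wpM2l ?(rp_B_ge0 reg)// ltW.
  have : e * W l w < eta by rewrite mulrC -ltr_pdivlMr.
  have : e * (enorm (u l y w) + B l w) <= e * W l w by rewrite ler_wpM2l// ltW.
  lra.
have [->|a0] := eqVneq (enorm a) 0.
  by rewrite expr0n mulr0 sumr_ge0// => l _; exact: sqr_ge0.
have a_gt0 : 0 < enorm a by rewrite lt0r a0 enorm_ge0.
have /unit_case : enorm ((enorm a)^-1 *: a) = 1.
  by rewrite enormZ ger0_norm ?invr_ge0 ?enorm_ge0// mulVf.
under eq_bigr do rewrite edotZl exprMn.
by rewrite -mulr_sumr exprVn mulrC ler_pdivlMr// exprn_gt0.
Qed.

End level.

(** * Integrable majorant for one block *)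

Section majorant.
Set Implicit Arguments.
Unset Strict Implicit.
Context {d : measure_display} {T : measurableType d} {R : realType}.
Variable P : probability T R.

(** Turns tail bounds into an integrable majorant: with i the first index such
    that w is outside E i, the variable c 0 + \sum_i c (i + 1) * 1_(E i)
    is at least c i. *)
Lemma level_majorant (E : nat -> set T) (c : nat -> R) (a : R) :
  (forall i, measurable (E i)) -> (forall i, 1 <= c i) ->
  (forall i, (c i.+1)%:E * P (E i) <= (a / 2 ^+ i.+1)%:E)%E ->
  exists Y : T -> \bar R, [/\ measurable_fun setT Y, forall w, (0 <= Y w)%E,
    (\int[P]_w Y w <= (c 0%N + a)%:E)%E &
    forall w v, Y w = v%:E -> exists i, ~ E i w /\ c i <= v].
Proof.
move=> mE c1 cE.
have c0 i : 0 <= c i := le_trans ler01 (c1 i).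
pose h i w : \bar R := ((c i.+1)%:E * (\1_(E i) w)%:E)%E.
have h0 i w : (0 <= h i w)%E by rewrite mule_ge0// lee_fin.
have mi i : measurable_fun setT (fun w => (\1_(E i) w)%:E : \bar R).
  by apply/measurable_EFinP; exact: measurable_indic.
have mh i : measurable_fun setT (h i) by exact: measurable_funeM.
pose Z w := (\sum_(i <oo) h i w)%E.
have Z0 w : (0 <= Z w)%E by apply: nneseries_ge0 => n _ _; exact: h0.
have mZ : measurable_fun setT Z by apply: ge0_emeasurable_sum => //.
have iZ : (\int[P]_w Z w <= a%:E)%E.
  rewrite integral_nneseries//.
  have ih i : (\int[P]_w h i w = (c i.+1)%:E * P (E i))%E.
    rewrite ge0_integralZl_EFin//.
    by rewrite integral_indic ?setIT.
  have := @cvg_geometric_eseries_half R a 0 => /cvg_lim; rewrite expr0 divr1 => <-//.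
  apply: lee_nneseries => i _; first by move=> _; exact: integral_ge0.
  rewrite ih; apply: le_trans (cE i) _.
  by rewrite lee_fin natrX addn1.
exists (fun w => (c 0%N)%:E + Z w)%E; split.
- by apply: emeasurable_funD.
- by move=> w; rewrite adde_ge0// lee_fin.
- rewrite ge0_integralD//; last by move=> w _; rewrite lee_fin.
  rewrite EFinD leeD// integral_cst//.
  by rewrite [X in (_ * X)%E]probability_setT mule1.
move=> w v Yw.
have Zv : (Z w <= v%:E)%E by rewrite -Yw leeDr ?lee_fin.
have cv : c 0%N <= v by rewrite -lee_fin -Yw leeDl.
have cZ i : E i w -> c i.+1 <= v.
  move=> Ew; rewrite -lee_fin; apply: le_trans Zv.
  have := @nneseries_lim_ge R (fun i => h i w) xpredT 0%N i.+1 (fun n _ _ => h0 n w).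
  apply: le_trans; rewrite big_nat_recr//= -[leLHS]add0e leeD//.
    by apply: sume_ge0 => k _; exact: h0.
  by rewrite /h indicE mem_set// mule1.
(* All the coefficients are at least 1, so the series is infinite at a point
   that lies in every E i. *)
have [i Ei] : exists i, w \notin E i.
  apply: contrapT => /forallNP allE.
  have Ew i : E i w by apply/set_mem; apply: contrapT => /negP; exact: allE.
  pose n := (Num.trunc v).+1.
  have := @nneseries_lim_ge R (fun i => h i w) xpredT 0%N n (fun n _ _ => h0 n w).
  move=> /le_trans/(_ Zv); apply/negP; rewrite -ltNge.
  apply: (@lt_le_trans _ _ n%:R%:E); first by rewrite lte_fin truncnS_gt.
  have -> : n%:R%:E = (\sum_(0 <= i < n) (1 : R)%:E)%E.
    by rewrite sumEFin big_const_nat iter_addr addr0 subn0.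
  apply: lee_sum => i _; rewrite /h indicE mem_set// mule1 lee_fin; exact: c1.
have := @ex_minnP (fun i => w \notin E i) (ex_intro _ i Ei).
case=> m Em minm; exists m; split; first by move=> ?; move/negP: Em; apply; exact/mem_set.
case: m Em minm => [|m] // Em minm; apply: cZ.
apply/set_mem; apply: contrapT => /negP/minm; by rewrite ltnn.
Qed.

(** Apply the small-ball estimate at the levels eta i = eta0 / 2^i with
    p = 2 * Q + 1: the coefficient of the event of level i is
    eta (i + 1) ^ (- 2 * Q), and its contribution to the mean is O(eta i). *)
Lemma block_majorant k r (S : set 'cV[R]_k) delta alpha M tau C1 C2 (Q : nat) :
  bounded_set S -> 0 < delta -> 0 < alpha -> 0 < M -> 0 < tau -> 0 < C1 -> 0 < C2 ->
  exists L K, [/\ (0 < L)%N, 0 <= K &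
  forall G (u : nat -> 'cV[R]_k -> T -> 'cV[R]_r) B,
  regular_process P S delta alpha M tau C1 C2 G u B ->
  exists Y : T -> \bar R, [/\ measurable_fun setT Y, forall w, (0 <= Y w)%E,
    (\int[P]_w Y w <= K%:E)%E &
    forall w v, Y w = v%:E -> exists y, [/\ 0 < y, y^-1 ^+ Q <= v &
      forall x (a : 'cV[R]_r), S x ->
        y * enorm a ^+ 2 <= \sum_(l < L) edot a (u l x w) ^+ 2]]].
Proof.
move=> bS delta0 alpha0 M0 tau0 C10 C20.
have [L [C [L0 C0 lev]]] := @small_ball_event _ _ _ P k r S delta alpha M tau C1 C2
  (2 * Q).+1 bS alpha0 M0 tau0 C10 C20.
pose eta0 := Num.min 1 (Num.min (delta / 4) (tau / 2)).
have eta0_gt0 : 0 < eta0 by rewrite !lt_min ltr01 !divr_gt0.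
have [eta0_1 eta0_d eta0_t] : [/\ eta0 <= 1, eta0 <= delta / 4 & eta0 <= tau / 2].
  by split; rewrite !ge_min lexx ?orbT.
pose eta i := eta0 / 2 ^+ i.
have etai_gt0 i : 0 < eta i by rewrite divr_gt0// exprn_gt0.
have etai_le i : eta i <= eta0.
  by rewrite ler_pdivrMr ?exprn_gt0// ler_peMr ?(ltW eta0_gt0)// exprn_ege1// ler1n.
pose c i := (eta i ^+ 2)^-1 ^+ Q.
exists L, (c 0%N + 2 * (4 ^+ Q * (C * eta0))); split => //.
  by rewrite addr_ge0 ?mulr_ge0 ?exprn_ge0 ?invr_ge0 ?exprn_ge0
    ?(ltW (etai_gt0 _)) ?(ltW C0) ?(ltW eta0_gt0).
move=> G u B reg.
have /choice[E HE] : forall i, exists E : set T, [/\ measurable E,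
    (P E <= (C * eta i ^+ (2 * Q).+1)%:E)%E &
    forall w, ~ E w -> forall x (a : 'cV[R]_r), S x ->
      eta i ^+ 2 * enorm a ^+ 2 <= \sum_(l < L) edot a (u l x w) ^+ 2].
  move=> i; apply: lev reg _ (etai_gt0 i) _ _ _; have := etai_le i; lra.
have [|||Y [mY Y0 iY YP]] := @level_majorant E c (2 * (4 ^+ Q * (C * eta0))).
- by move=> i; have [] := HE i.
- move=> i; rewrite exprn_ege1// invf_ge1 ?exprn_gt0// exprn_ile1 ?(ltW (etai_gt0 i))//.
  exact: le_trans (etai_le i) eta0_1.
- move=> i; have [_ PE _] := HE i.
  have c0 : 0 <= c i.+1 by rewrite exprn_ge0// invr_ge0 exprn_ge0 ?(ltW (etai_gt0 _)).
  apply: (@le_trans _ _ ((c i.+1)%:E * (C * eta i ^+ (2 * Q).+1)%:E)%E).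
    by rewrite lee_wpmul2l.
  rewrite -EFinM lee_fin le_eqVlt; apply/orP; left; apply/eqP.
  have e2 : eta i = 2 * eta i.+1 by rewrite /eta exprS; field; rewrite expf_neq0.
  have -> : 2 * (4 ^+ Q * (C * eta0)) / 2 ^+ i.+1 = 4 ^+ Q * (C * eta i).
    by rewrite /eta exprS; field; rewrite expf_neq0.
  have x0 : eta i.+1 != 0 by rewrite gt_eqF.
  rewrite /c exprVn e2; move: (eta i.+1) x0 => x x0.
  rewrite [(2 * x) ^+ _]exprS exprM [(2 * x) ^+ 2]exprMn -[2 ^+ 2]natrX [(_ * x ^+ 2) ^+ Q]exprMn.
  by field; rewrite expf_neq0// expf_neq0.
exists Y; split => // w v /YP[i [nE cv]].
have [_ _ /(_ w nE) h] := HE i.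
by exists (eta i ^+ 2); split => //; rewrite exprn_gt0.
Qed.

End majorant.

(** * Averaging over blocks *)

Section assembly.
Set Implicit Arguments.
Unset Strict Implicit.
Context {R : realType}.

Lemma bernoulli_ineq (x : R) n : 0 <= x -> 1 + n%:R * (x - 1) <= x ^+ n.
Proof.
move=> x0; elim: n => [|n IH]; first by rewrite mul0r addr0.
rewrite exprS -nat1r; apply: le_trans (ler_wpM2l x0 IH).
have : 0 <= n%:R * (x - 1) ^+ 2 by rewrite mulr_ge0// sqr_ge0.
nra.
Qed.

(** Jensen's inequality for x |-> x ^ (- n), from its tangent at the mean. *)
Lemma mean_inv_exprn_le (J n : nat) (y : 'I_J -> R) : (0 < J)%N ->
  (forall j, 0 < y j) ->
  (J%:R^-1 * \sum_j y j)^-1 ^+ n <= J%:R^-1 * \sum_j (y j)^-1 ^+ n.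
Proof.
move=> J0 y0; have JR : 0 < J%:R :> R by rewrite ltr0n.
set m := J%:R^-1 * \sum_j y j.
have m0 : 0 < m.
  rewrite mulr_gt0 ?invr_gt0// (bigD1 (Ordinal J0))//= ltr_pwDl// sumr_ge0// => j _.
  exact: ltW.
have mi0 : 0 <= m^-1 ^+ n by rewrite exprn_ge0// invr_ge0 ltW.
rewrite mulrC ler_pdivlMr//.
(* Each y j ^ (- n) is above the tangent at m; the tangents sum to J * m ^ (- n). *)
apply: (@le_trans _ _ (\sum_(j < J) m^-1 ^+ n * (1 + n%:R * (1 - y j / m)))).
  rewrite -mulr_sumr big_split /= sumr_const card_ord -mulr_sumr sumrB.
  rewrite sumr_const card_ord -mulr_suml ler_wpM2l//.
  have -> : (\sum_j y j) / m = J%:R.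
    have s0 : \sum_j y j != 0 by apply: contraTneq m0 => s0; rewrite /m s0 mulr0 ltxx.
    by rewrite /m invfM invrK mulrCA mulfV ?mulr1.
  by rewrite subrr mulr0 addr0.
apply: ler_sum => j _.
have -> : (y j)^-1 ^+ n = m^-1 ^+ n * (m / y j) ^+ n.
  by rewrite -exprMn mulrA mulVf ?mul1r// gt_eqF.
rewrite ler_wpM2l//; apply: le_trans (bernoulli_ineq n _); last first.
  by rewrite divr_ge0// ltW.
rewrite lerD2l ler_wpM2l//.
have yj := y0 j.
rewrite -subr_ge0.
have -> : m / y j - 1 - (1 - y j / m) = (m - y j) ^+ 2 / (m * y j).
  by field; rewrite !gt_eqF.
by rewrite divr_ge0 ?sqr_ge0// mulr_ge0// ltW.
Qed.

(** The summand 1 pays for replacing the real exponent q by the integer n. *)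
Lemma lambda_min_negpow_le r (A : 'M[R]_r) q c n : 0 < c -> c <= lambda_min A ->
  0 <= q -> q <= n%:R -> (lambda_min_negpow q A <= (1 + c^-1 ^+ n)%:E)%E.
Proof.
move=> c0 cA q0 qn; have l0 := lt_le_trans c0 cA.
rewrite /lambda_min_negpow gt_eqF// lee_fin powRN.
have ci0 : 0 <= c^-1 by rewrite invr_ge0 ltW.
apply: (@le_trans _ _ (c^-1 `^ q)).
  rewrite -[leLHS]powR_inv1 ?powR_ge0// -powRrM mulrC powRrM powR_inv1 ?(ltW l0)//.
  by apply: ge0_ler_powR; rewrite ?nnegrE ?invr_ge0 ?(ltW l0) ?(ltW c0) ?lef_pV2.
have [c1|/ltW c1] := leP c^-1 1.
  apply: (@le_trans _ _ 1); last by rewrite lerDl exprn_ge0.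
  have <- : (1 : R) `^ q = 1 by rewrite powR1.
  by apply: ge0_ler_powR; rewrite ?nnegrE.
apply: (@le_trans _ _ (c^-1 ^+ n)); last by rewrite lerDr.
by rewrite -powR_mulrn//; apply: ler_powR.
Qed.

Lemma sum_blocks (h : nat -> R) J L :
  \sum_(j < J) \sum_(l < L) h (j * L + l)%N = \sum_(m < J * L) h m.
Proof.
elim: J => [|J IH]; first by rewrite mul0n !big_ord0.
rewrite big_ord_recr /= IH -(big_mkord xpredT) mulSnr.
rewrite -[RHS](big_mkord xpredT) [RHS](@big_cat_nat _ _ _ (J * L)) ?leq_addr//=.
congr (_ + _).
rewrite -[X in \sum_(X <= _ < _) _]add0n big_addn addKn.
by rewrite big_mkord; apply: eq_bigr => l _; rewrite addnC.
Qed.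

Lemma sum_subsampled_le (g : nat -> R) d N n : (0 < d)%N ->
  (forall t, 0 <= g t) -> (d * N.+1 <= n)%N ->
  \sum_(m < N) g (d * m.+2)%N <= \sum_(1 <= t < n.+1) g t.
Proof.
move=> d0 g0 dn.
(* The bound is proved by induction on N for the shortest admissible range. *)
apply: (@le_trans _ _ (\sum_(1 <= t < (d * N.+1).+1) g t)); last first.
  rewrite [leRHS](@big_cat_nat _ _ _ (d * N.+1).+1) ?ltnS//= lerDl.
  by rewrite sumr_ge0.
elim: N {dn} => [|N IH]; first by rewrite big_ord0 sumr_ge0.
rewrite big_ord_recr /= (@big_cat_nat _ _ _ (d * N.+1).+1)//=; last first.
  by rewrite ltnS leq_mul2l leqnSn orbT.
rewrite lerD// big_nat_recr/=; last by rewrite ltn_mul2l d0 ltnSn.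
by rewrite lerDr sumr_ge0.
Qed.

(** J blocks of L observations spaced by d fit within the times 1, ..., n, and
    fill a fixed proportion of them. *)
Lemma block_count d L n : (0 < d)%N -> (0 < L)%N -> (d * L.+1 <= n)%N ->
  exists J, [/\ (0 < J)%N, (d * (J * L).+1 <= n)%N & (n <= 3 * d * L * J)%N].
Proof.
move=> d0 L0 dn; exists ((n %/ d).-1 %/ L)%N.
have nd : (L.+1 <= n %/ d)%N by rewrite leq_divRL// mulnC.
have J0 : (0 < (n %/ d).-1 %/ L)%N by rewrite divn_gt0//; lia.
split => //.
  have h1 := leq_divM (n %/ d).-1 L; have h2 := leq_divM n d.
  apply: leq_trans h2; rewrite mulnC leq_mul2r.
  by apply/orP; right; lia.
have h1 := ltn_ceil (n %/ d).-1 L0; have h2 := ltn_ceil n d0.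
move: J0 h1 h2; set J := (_ %/ L)%N; set D := (n %/ d)%N => J0 h1 h2.
have h3 : (D <= J.+1 * L)%N by lia.
have h4 : (D.+1 <= 3 * L * J)%N by nia.
apply: leq_trans (ltnW h2) _.
have : (D.+1 * d <= 3 * L * J * d)%N by rewrite leq_mul2r h4 orbT.
nia.
Qed.

End assembly.

(** * Boundedness of the negative moments *)

Theorem theorem2p1
  (R : realType) (disp : measure_display) (Omega : measurableType disp)
  (P : probability Omega R)
  (F : nat -> set (set Omega)) (F_filtration : is_filtration F)
  (k r : nat) (r_gt0 : (0 < r)%N)
  (Theta : set 'cV[R]_k)
  (f : nat -> 'cV[R]_k -> Omega -> 'cV[R]_r)
  (f_adapted : forall t theta, (1 <= t)%N -> Theta theta ->
     forall i : 'I_r, measurable_wrt (F t) (fun w => f t theta w i ord0))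
  (Theta_bounded : bounded_set Theta)
  (f_continuous : forall t w, (1 <= t)%N ->
     {within Theta, continuous (fun theta => f t theta w)})
  (d : nat) (d_gt0 : (0 < d)%N)
  (delta alpha M : R)
  (delta_gt0 : 0 < delta) (alpha_gt0 : 0 < alpha) (M_gt0 : 0 < M)
  (f_nonconcentrated : forall (t : nat) (s1 s2 : R) (theta : 'cV[R]_k)
      (a : 'cV[R]_r),
     (d < t)%N -> 0 < s2 - s1 -> s2 - s1 <= delta -> Theta theta ->
     enorm a = 1 ->
     cond_prob_le P (F (t - d)%N)
       [set w | s1 < (a^T *m f t theta w) ord0 ord0 <= s2]
       (M * (s2 - s1) `^ alpha))
  (tau : R) (tau_gt0 : 0 < tau)
  (B : nat -> {RV P >-> R})
  (B_ge0 : forall t w, (1 <= t)%N -> 0 <= B t w)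
  (C1 : R) (C1_gt0 : 0 < C1)
  (B_bounded : (ereal_sup [set 'E_P[B t] | t in [set t | (1 <= t)%N]]
     <= C1%:E)%E)
  (f_lipschitz : forall (t : nat) (xi1 xi2 : 'cV[R]_k),
     (1 <= t)%N -> Theta xi1 -> Theta xi2 -> enorm (xi1 - xi2) < tau ->
     {ae P, forall w,
        enorm (f t xi1 w - f t xi2 w) <= B t w * enorm (xi1 - xi2)})
  (C2 : R) (C2_gt0 : 0 < C2)
  (f_second_moment :
     (ereal_sup
        [set \int[P]_w
               ereal_sup [set (enorm (f t theta w) ^+ 2)%:E
                         | theta in Theta]
        | t in [set t | (1 <= t)%N]] <= C2%:E)%E)
  (q : R) (q_ge1 : 1 <= q) :
  (* For nonempty Theta these expectations lie in [0, +oo], so a finite upper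
     bound is exactly finiteness and boundedness. *)
  exists K : R, \forall n \near \oo,
    (\int[P]_w
       ereal_sup
         [set lambda_min_negpow q
                (second_moment_matrix (fun t => f t theta w) n)
         | theta in Theta] <= K%:E)%E.
Proof.
have [Fsigma Fmeas Fmono] := F_filtration.
pose Q := (Num.trunc q).+1.
have qQ : q <= Q%:R by rewrite ltW// truncnS_gt.
have [L [K [L0 K0 maj]]] := @block_majorant _ _ _ P k r Theta delta alpha M tau C1 C2 Q
  Theta_bounded delta_gt0 alpha_gt0 M_gt0 tau_gt0 C1_gt0 C2_gt0.
have second_moment t x : (1 <= t)%N -> Theta x ->
    (\int[P]_w (enorm (f t x w) ^+ 2)%:E <= C2%:E)%E.
  move=> t1 Tx; apply: le_trans f_second_moment; apply: le_trans; last first.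
    by apply: ereal_sup_ubound; exists t.
  apply: le_integral_nonmeasurable => w.
    apply: (@le_trans _ _ (enorm (f t x w) ^+ 2)%:E); first by rewrite lee_fin sqr_ge0.
    by apply: ereal_sup_ubound; exists x.
  by apply: ereal_sup_ubound; exists x.
have meanB t : (1 <= t)%N -> (\int[P]_w (B t w)%:E <= C1%:E)%E.
  move=> t1; apply: le_trans B_bounded.
  by apply: ereal_sup_ubound; exists t => //; rewrite unlock.
have s1 m : (1 <= d * m.+1)%N by rewrite muln_gt0 d_gt0.
(* Block j consists of the times d * (m + 2) for j * L <= m < (j + 1) * L: each
   exceeds d, and d units before it is the previous time of this sequence. *)
have reg j : regular_process P Theta delta alpha M tau C1 C2
    (fun l => F (d * (j * L + l).+1)%N)
    (fun l => f (d * (j * L + l).+2)%N) (fun l => B (d * (j * L + l).+2)%N).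
  split.
  - by move=> l; exact: Fsigma.
  - by move=> l; exact: Fmeas.
  - by move=> l; apply: Fmono; rewrite ?leq_mul2l ?addnS ?leqnSn ?orbT.
  - by move=> l x Tx i; rewrite addnS; exact: f_adapted.
  - move=> l u v x a uv uvd Tx a1.
    have -> : (d * (j * L + l).+1 = d * (j * L + l).+2 - d)%N.
      by rewrite [(d * _.+2)%N]mulnS addKn.
    apply: f_nonconcentrated => //.
    by rewrite -[X in (X < _)%N]muln1 ltn_mul2l d_gt0.
  - by move=> l w; exact: B_ge0.
  - by move=> l; exact: measurable_funPT.
  - by move=> l; exact: meanB.
  - move=> l; apply: ae_lipschitz => //.
    + by move=> w; exact: f_continuous.
    + by move=> w; exact: B_ge0.
    + by move=> x y Tx Ty xy; exact: f_lipschitz.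
  - by move=> l x; exact: second_moment.
have /choice[Y HY] := fun j => maj _ _ _ (reg j).
pose A : R := (3 * d * L)%:R.
have A0 : 0 < A by rewrite ltr0n !muln_gt0 d_gt0 L0.
exists (1 + A ^+ Q * K).
exists (d * L.+1)%N => // n /= nL.
have [J [J0 Jn nJ]] := block_count d_gt0 L0 nL.
have JR : 0 < J%:R :> R by rewrite ltr0n.
(* The majorant H is 1 plus A ^+ Q times the average of the block majorants,
   where A bounds the ratio of n to the number of blocks. *)
pose c := A ^+ Q / J%:R.
have c0 : 0 < c by rewrite divr_gt0 ?exprn_gt0.
pose H w := (1 + c%:E * \sum_(j < J) Y j w)%E.
have Y0 j w : (0 <= Y j w)%E by have [] := HY j.
have SY0 w : (0 <= \sum_(j < J) Y j w)%E by apply: sume_ge0.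
have mSY : measurable_fun setT (fun w => \sum_(j < J) Y j w)%E.
  by apply: emeasurable_sum => j; have [] := HY j.
have H0 w : (0 <= H w)%E by rewrite adde_ge0// mule_ge0// lee_fin ltW.
have intH : (\int[P]_w H w <= (1 + A ^+ Q * K)%:E)%E.
  rewrite ge0_integralD//; last 2 first.
  - by move=> w _; rewrite mule_ge0// lee_fin ltW.
  - exact: measurable_funeM.
  rewrite integral_cst// mul1e EFinD leeD ?probability_le1//.
  rewrite ge0_integralZl_EFin ?(ltW c0)//.
  rewrite ge0_integral_sum//; last by move=> j; have [] := HY j.
  apply: (@le_trans _ _ (c%:E * (\sum_(j < J) K%:E))%E).
    by rewrite lee_wpmul2l ?lee_fin ?(ltW c0)//; apply: lee_sum => j _; have [] := HY j.
  rewrite sumEFin -EFinM lee_fin sumr_const card_ord -[K *+ J]mulr_natr /c.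
  by rewrite mulrCA -mulrA mulVf ?mulr1 1?mulrC// gt_eqF.
apply: le_trans intH; apply: le_integral_nonmeasurable => // w.
apply: ub_ereal_sup => _ [x Tx <-].
have [Yfin|/existsNP[j Yj]] := pselect (forall j : 'I_J, Y j w != +oo%E); last first.
  have -> : H w = +oo%E; last exact: leey.
  have Yw : Y j w = +oo%E by apply/eqP; apply: contrapT => /negP.
  rewrite /H; have -> : (\sum_(j < J) Y j w = +oo)%E.
    apply/eqP; rewrite eq_le leey /= (bigD1 j)//= Yw addye// -ltNye.
    by apply: lt_le_trans (sume_ge0 _ _) => // i _.
  by rewrite gt0_muley ?lte_fin// addey.
have Yf (j : 'I_J) : Y j w \is a fin_num.
  by rewrite ge0_fin_numE// ltey; exact: Yfin.
have /choice[y Hy] : forall j : 'I_J, exists y, [/\ 0 < y, y^-1 ^+ Q <= fine (Y j w) &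
      forall x (a : 'cV[R]_r), Theta x ->
        y * enorm a ^+ 2 <= \sum_(l < L) edot a (f (d * (j * L + l).+2)%N x w) ^+ 2].
  by move=> j; have [_ _ _] := HY j; apply; rewrite fineK.
have y0 j : 0 < y j by have [] := Hy j.
pose m := J%:R^-1 * \sum_j y j.
have Sy0 : 0 < \sum_j y j.
  by rewrite (bigD1 (Ordinal J0))//= ltr_pwDl// sumr_ge0// => j _; exact: ltW.
have m0 : 0 < m by rewrite mulr_gt0 ?invr_gt0.
(* Keeping only the block observations, the smallest eigenvalue is at least
   m / A, where m is the average of the lower bounds y j of the blocks. *)
have lam : m / A <= lambda_min (second_moment_matrix (fun t => f t x w) n).
  apply: lambda_min_ge => //; first exact: second_moment_matrix_sym.
  move=> a; rewrite second_moment_quad.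
  have n0 : 0 < n%:R :> R by rewrite ltr0n (leq_trans _ nL).
  have h1 : (\sum_j y j) * enorm a ^+ 2 <= \sum_(1 <= t < n.+1) edot a (f t x w) ^+ 2.
    apply: le_trans (sum_subsampled_le d_gt0 (fun t => sqr_ge0 _) Jn).
    rewrite -(sum_blocks (fun m => edot a (f (d * m.+2)%N x w) ^+ 2)) mulr_suml.
    apply: ler_sum => j _; by have [_ _] := Hy j; apply.
  have h2 : m / A <= n%:R^-1 * \sum_j y j.
    rewrite /m mulrAC ler_wpM2r ?(ltW Sy0)// -invfM lef_pV2 ?posrE ?mulr_gt0//.
    by rewrite mulrC -natrM ler_nat.
  apply: (@le_trans _ _ (n%:R^-1 * (\sum_j y j) * enorm a ^+ 2)).
    by rewrite ler_wpM2r// sqr_ge0.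
  by rewrite -mulrA ler_wpM2l// invr_ge0 ltW.
have q0 : 0 <= q by exact: le_trans q_ge1.
apply: le_trans (lambda_min_negpow_le (divr_gt0 m0 A0) lam q0 qQ) _.
rewrite /H EFinD leeD//.
have -> : (\sum_(j < J) Y j w = (\sum_(j < J) fine (Y j w))%:E)%E.
  by rewrite -sumEFin; apply: eq_bigr => j _; rewrite fineK.
rewrite -EFinM lee_fin invf_div exprMn /c -mulrA ler_wpM2l ?exprn_ge0 ?(ltW A0)//.
apply: le_trans (mean_inv_exprn_le _ J0 y0) _.
rewrite ler_wpM2l ?invr_ge0 ?(ltW JR)//; apply: ler_sum => j _.
by have [] := Hy j.
Qed.
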